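(* Let $r_1,r_2>0$ be real numbers. For either choice of sign, substitute $r_3=\xi^2$ in the right-hand side of the Descartes formula $$\frac1{r_4}=\frac1{r_1}+\frac1{r_2}+\frac1{r_3}\pm2\sqrt{\frac1{r_1r_2}+\frac1{r_2r_3}+\frac1{r_3r_1}},$$ written in the form $$g_\pm(\xi)=\frac1{r_1}+\frac1{r_2}+\frac1{\xi^2}\pm\frac{2}{\xi}\sqrt{\frac{\xi^2}{r_1r_2}+\left(\frac1{r_1}+\frac1{r_2}\right)}.$$ Then the value of $g_\pm$ at $\xi=0$ by the division by zero calculus is $$\frac1{r_1}+\frac1{r_2}.$$ Consequently the circle $(r_1+r_2)(x^2+y^2)-2r_1r_2y=0$, whose radius $r_4=\frac{r_1r_2}{r_1+r_2}$ satisfies $\frac1{r_4}=\frac1{r_1}+\frac1{r_2}$, satisfies the Descartes formula for $r_3=0$ in the sense of the division by zero calculus.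
   Context: Division by zero calculus: if a function $f$ has a Laurent expansion $f(\xi)=\sum_{n=-\infty}^{\infty}C_n(\xi-a)^n$ around $\xi=a$, its value at $a$ by the division by zero calculus is defined to be $f(a):=C_0$ (with the convention $0^0=1$). The square root in $g_\pm$ denotes the branch analytic near $\xi=0$ that is positive at $\xi=0$. *)

(* Defs.v *)
From Stdlib Require Export Reals ZArith.
From Coquelicot Require Export Coquelicot.

Open Scope R_scope.

Definition analytic_at (f : C -> C) (a : C) : Prop :=
  exists (rho : R) (c : nat -> C), 0 < rho /\
    forall z : C, Cmod (z - a) < rho -> is_pseries c (z - a)%C (f z).

(* [f] is the sum of sum_{n in Z} c n (z - a)^n on a punctured disc around [a].
   The regular part (n >= 0) and the principal part (n = -(k+1), k >= 0)
   converge separately; [f a] itself is unconstrained. *)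
Definition is_laurent (f : C -> C) (a : C) (c : Z -> C) : Prop :=
  exists rho : R, 0 < rho /\
    forall z : C, 0 < Cmod (z - a) < rho ->
      exists p q : C,
        is_series (fun n : nat => c (Z.of_nat n) * (z - a) ^ n)%C p /\
        is_series (fun k : nat => c (- Z.of_nat (S k))%Z * / (z - a) ^ (S k))%C q /\
        f z = (p + q)%C.

(* [v] is the value of [f] at [a] by the division by zero calculus: [f] has a
   Laurent expansion around [a], and the constant coefficient is [v].  The
   second clause makes single-valuedness part of the notion. *)
Definition is_dzc_value (f : C -> C) (a v : C) : Prop :=
  (exists c : Z -> C, is_laurent f a c) /\
  (forall c : Z -> C, is_laurent f a c -> c 0%Z = v).

(* Right-hand side of the Descartes formula; [sgn] is 1 or -1. *)
Definition descartes_rhs (sgn r1 r2 r3 : R) : R :=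
  1 / r1 + 1 / r2 + 1 / r3
  + sgn * (2 * sqrt (1 / (r1 * r2) + 1 / (r2 * r3) + 1 / (r3 * r1))).

Definition radicand (r1 r2 : R) (xi : C) : C :=
  (xi ^ 2 / RtoC (r1 * r2) + (1 / RtoC r1 + 1 / RtoC r2))%C.

(* [s] represents the branch of the square root of [radicand r1 r2] that is
   analytic near 0 and positive at 0; away from 0 it is unconstrained. *)
Definition is_sqrt_branch (r1 r2 : R) (s : C -> C) : Prop :=
  analytic_at s 0 /\
  (exists delta : R, 0 < delta /\
     forall xi : C, Cmod xi < delta -> (s xi ^ 2)%C = radicand r1 r2 xi) /\
  (exists x : R, 0 < x /\ s 0 = RtoC x).

Definition g (sgn r1 r2 : R) (s : C -> C) (xi : C) : C :=
  (1 / RtoC r1 + 1 / RtoC r2 + 1 / xi ^ 2 + RtoC sgn * (2 / xi * s xi))%C.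

Definition is_circle_of_radius (P : R -> R -> Prop) (r : R) : Prop :=
  0 < r /\
  exists x0 y0 : R, forall x y : R, P x y <-> (x - x0) ^ 2 + (y - y0) ^ 2 = r ^ 2.

(* A circle of radius [r4] satisfies the Descartes formula for r3 = 0: the
   reciprocal of [r4] is the value at xi = 0, by the division by zero calculus,
   of the right-hand side with r3 = xi^2. *)
Definition dzc_descartes_r3_zero (sgn r1 r2 : R) (s : C -> C) (r4 : R) : Prop :=
  is_dzc_value (g sgn r1 r2 s) 0 (RtoC (1 / r4)).

(* Main.v *)
Require Import Defs.
From Stdlib Require Import Reals ZArith.
From Coquelicot Require Import Coquelicot.
From Stdlib Require Import Lia Lra ClassicalEpsilon.

(** Write [A = 1 / (r1 r2)] and [B = 1 / r1 + 1 / r2], so that a branch [s]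
    satisfies [s z ^ 2 = A z ^ 2 + B] near [0].  If [s z = c0 + c1 z + c2 z ^ 2 + ...],
    comparing the terms of degree one of both sides gives [2 c0 c1 = 0], hence
    [c1 = 0] because [c0 = s 0 > 0] ([sqrt_branch_coef_1]).  Therefore
    [B + 1 / z ^ 2 + (2 sgn / z) s z] has the Laurent expansion
    [1 / z ^ 2 + 2 sgn c0 / z + (B + 2 sgn c1) + ...]
    ([laurent_of_shifted_pseries]), whose constant term is [B].

    The value given by the division by zero calculus is well defined only if all
    Laurent expansions of a function share their constant term
    ([laurent_coeff_0_unique]).  Instead of a contour integral, the proof uses the
    mean of [f] over the [N]-th roots of unity scaled to a small circle: the mean
    of [z ^ n] vanishes unless [N] divides [n], so the mean of [f] differs from the
    constant term only by coefficients of index at least [N] in absolute value,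
    and these contribute [O(2 ^ -N)] on a suitable circle.

    A branch exists because the formal square root
    [b + c2 z ^ 2 + ...] of [B (1 + k z ^ 2)], with [b = sqrt B] and [k = A / B], has
    coefficients given by a two-term recurrence.  Multiplying that recurrence out shows that the
    coefficients of its Cauchy square satisfy a two-term recurrence as well, which
    kills all of them after degree two ([sqrt_self_conv_values]); the recurrence
    also bounds the coefficients geometrically, and the Cauchy product of
    absolutely convergent complex series ([Cseries_mult]) turns the formal identity
    into an identity of functions.

    For small positive real [xi] the number [s xi] is a square root of a positive
    real close to [s 0 > 0], hence the positive one
    ([sqrt_branch_real_positive]). *)

(** * Series of complex numbers *)

Local Notation Cseries := (@is_series C_AbsRing C_NormedModule).

(** A constant, so that equations between partial sums have type [C] and not the
    carrier of an abstract monoid, where [ring] does not apply. *)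
Definition Csum (a : nat -> C) (n : nat) : C := sum_n a n.

Lemma Csum_O (a : nat -> C) : Csum a 0 = a 0%nat.
Proof. exact (sum_O a). Qed.

Lemma Csum_S (a : nat -> C) n : Csum a (S n) = (Csum a n + a (S n))%C.
Proof. exact (sum_Sn a n). Qed.

(** Convergence in [C_NormedModule] is stated with the product topology of
    [R * R]; the estimates below need it in terms of [Cmod]. *)
Lemma Cseries_eps (a : nat -> C) (l : C) :
  Cseries a l <->
  forall eps : R, 0 < eps ->
    exists N, forall n, (N <= n)%nat -> Cmod (Csum a n - l) < eps.
Proof.
  unfold is_series.
  rewrite (filterlim_locally_ball_norm (K := C_AbsRing) (U := C_NormedModule)).
  split; intros H.
  - intros eps He. exact (H (mkposreal eps He)).
  - intros eps. exact (H eps (cond_pos eps)).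
Qed.

Lemma Cseries_ext (a b : nat -> C) (l : C) :
  (forall n, a n = b n) -> Cseries a l -> Cseries b l.
Proof. exact (is_series_ext a b l). Qed.

Lemma Cseries_plus (a b : nat -> C) (la lb : C) :
  Cseries a la -> Cseries b lb -> Cseries (fun n => a n + b n)%C (la + lb)%C.
Proof. exact (is_series_plus a b la lb). Qed.

Lemma Cseries_scal (k : C) (a : nat -> C) (l : C) :
  Cseries a l -> Cseries (fun n => k * a n)%C (k * l)%C.
Proof. exact (is_series_scal k a l). Qed.

Lemma Cseries_tail (a : nat -> C) (l : C) :
  Cseries a l -> Cseries (fun n => a (S n)) (l - a 0%nat)%C.
Proof.
  intros H. apply is_series_incr_1.
  change (Cseries a (l - a 0%nat + a 0%nat)%C).
  now replace (l - a 0%nat + a 0%nat)%C with l by ring.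
Qed.

Lemma Cseries_cons (a : nat -> C) (l : C) :
  Cseries (fun n => a (S n)) l -> Cseries a (a 0%nat + l)%C.
Proof.
  intros H. apply is_series_decr_1.
  change (Cseries (fun n => a (S n)) (a 0%nat + l + - a 0%nat)%C).
  now replace (a 0%nat + l + - a 0%nat)%C with l by ring.
Qed.

Lemma Cseries_0 : Cseries (fun _ : nat => RtoC 0) (RtoC 0).
Proof.
  apply Cseries_eps. intros eps He. exists 0%nat. intros n _.
  replace (Csum (fun _ : nat => RtoC 0) n) with (RtoC 0).
  - replace (RtoC 0 - RtoC 0)%C with (RtoC 0) by ring. rewrite Cmod_0. exact He.
  - induction n as [|n IH]; [now rewrite Csum_O|].
    rewrite Csum_S, <- IH. ring.
Qed.

Lemma pow_n_Cpow (z : C) n : @pow_n C_Ring z n = (z ^ n)%C.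
Proof. induction n as [|n IH]; [reflexivity|]. simpl. now rewrite IH. Qed.

Lemma is_pseries_Cpow (c : nat -> C) (z l : C) :
  @is_pseries C_AbsRing C_NormedModule c z l
  <-> Cseries (fun n => c n * z ^ n)%C l.
Proof.
  assert (E : forall n, scal (@pow_n C_Ring z n) (c n) = (c n * z ^ n)%C).
  { intros n. rewrite pow_n_Cpow. change (z ^ n * c n = c n * z ^ n)%C. ring. }
  split; intros H; unfold is_pseries in *;
    (eapply is_series_ext; [|exact H]); intros n; [exact (E n)|symmetry; exact (E n)].
Qed.

Lemma Cseries_terms_bounded (a : nat -> C) (l : C) :
  Cseries a l -> exists M, 0 < M /\ forall n, Cmod (a n) <= M.
Proof.
  intros H. rewrite Cseries_eps in H.
  destruct (H 1 Rlt_0_1) as [N HN].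
  assert (Hfin : forall K, exists M, 0 < M /\ forall n, (n <= K)%nat -> Cmod (a n) <= M).
  { induction K as [|K [M [M0 HM]]].
    - exists (Cmod (a 0%nat) + 1). pose proof (Cmod_ge_0 (a 0%nat)). split; [lra|].
      intros n Hn. replace n with 0%nat by lia. lra.
    - exists (M + Cmod (a (S K))). pose proof (Cmod_ge_0 (a (S K))). split; [lra|].
      intros n Hn. destruct (Nat.eq_dec n (S K)) as [->|]; [lra|].
      specialize (HM n ltac:(lia)). lra. }
  destruct (Hfin N) as [M [M0 HM]]. exists (M + 2). split; [lra|]. intros n.
  destruct (Nat.le_gt_cases n N) as [Hn|Hn]; [specialize (HM n Hn); lra|].
  destruct n as [|n]; [lia|].
  replace (a (S n)) with ((Csum a (S n) - l) + - (Csum a n - l))%C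
    by (rewrite Csum_S; ring).
  eapply Rle_trans; [apply Cmod_triangle|]. rewrite Cmod_opp.
  pose proof (HN n ltac:(lia)). pose proof (HN (S n) ltac:(lia)). lra.
Qed.

Lemma Csum_Cmod_le (a : nat -> C) n : Cmod (Csum a n) <= sum_n (fun k => Cmod (a k)) n.
Proof.
  induction n as [|n IH]; [rewrite Csum_O, sum_O; lra|].
  rewrite Csum_S, sum_Sn. eapply Rle_trans; [apply Cmod_triangle|].
  apply Rplus_le_compat_r. exact IH.
Qed.

Lemma Cseries_Cmod_le (a : nat -> C) (l : C) (B : R) :
  Cseries a l -> (forall n, Cmod (Csum a n) <= B) -> Cmod l <= B.
Proof.
  intros H HB. apply Rnot_lt_le. intros Hlt. rewrite Cseries_eps in H.
  destruct (H (Cmod l - B)) as [N HN]; [lra|].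
  specialize (HN N (le_n N)).
  assert (T := Cmod_triangle (Csum a N) (- (Csum a N - l))%C).
  rewrite Cmod_opp in T.
  replace (Csum a N + - (Csum a N - l))%C with l in T by ring.
  specialize (HB N). lra.
Qed.

Lemma Cseries_half_bound (a : nat -> C) (l : C) (M : R) :
  Cseries a l -> (forall n, Cmod (a n) <= M * (1/2) ^ n) -> Cmod l <= 2 * M.
Proof.
  intros H HM. apply (Cseries_Cmod_le a l _ H). intros n.
  assert (M0 : 0 <= M).
  { specialize (HM 0%nat). pose proof (Cmod_ge_0 (a 0%nat)). simpl in HM. lra. }
  enough (Cmod (Csum a n) <= 2 * M - M * (1/2) ^ n).
  { pose proof (pow_lt (1/2) n ltac:(lra)).
    assert (0 <= M * (1/2)^n) by (apply Rmult_le_pos; lra). lra. }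
  induction n as [|n IH].
  - rewrite Csum_O. specialize (HM 0%nat). simpl in *. lra.
  - rewrite Csum_S. eapply Rle_trans; [apply Cmod_triangle|].
    specialize (HM (S n)). simpl in *. lra.
Qed.

(** The first [j] terms contribute nothing, so the sum of the dominating geometric
    series starts at [(1/2) ^ j]: this is what makes the means over roots of unity
    converge. *)
Lemma Cseries_half_bound_from (j : nat) : forall (a : nat -> C) (l : C) (M : R),
  Cseries a l -> (forall n, (n < j)%nat -> a n = 0%C) ->
  (forall n, Cmod (a n) <= M * (1/2) ^ n) -> Cmod l <= 2 * M * (1/2) ^ j.
Proof.
  induction j as [|j IH]; intros a l M H H0 HM.
  - simpl. rewrite Rmult_1_r. now apply (Cseries_half_bound a).
  - apply Cseries_tail in H. rewrite (H0 0%nat ltac:(lia)) in H.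
    replace (l - 0)%C with l in H by ring.
    replace (2 * M * (1/2) ^ S j) with (2 * (M / 2) * (1/2) ^ j) by (simpl; field).
    apply (IH _ l (M/2) H).
    + intros n Hn. apply H0. lia.
    + intros n. eapply Rle_trans; [apply HM|]. simpl. right. field.
Qed.

(** * Means over roots of unity and the constant Laurent coefficient *)

Lemma Csum_ext (a b : nat -> C) n :
  (forall k, (k <= n)%nat -> a k = b k) -> Csum a n = Csum b n.
Proof. exact (sum_n_ext_loc a b n). Qed.

Lemma Csum_scal (u : C) (a : nat -> C) n :
  Csum (fun k => u * a k)%C n = (u * Csum a n)%C.
Proof. exact (sum_n_mult_l (K := C_Ring) u a n). Qed.

(** The primitive root of unity [exp (2 i pi / N)]. *)
Definition unit_root (N : nat) : C :=
  (cos (2 * PI / INR N), sin (2 * PI / INR N)).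

Lemma Cpow_cos_sin (t : R) (n : nat) :
  ((cos t, sin t) ^ n)%C = (cos (INR n * t), sin (INR n * t)).
Proof.
  induction n as [|n IH].
  - simpl. now rewrite Rmult_0_l, cos_0, sin_0.
  - rewrite Cpow_S, IH, S_INR. unfold Cmult; simpl.
    replace ((INR n + 1) * t) with (t + INR n * t) by ring.
    rewrite cos_plus, sin_plus. f_equal; ring.
Qed.

Lemma Cmod_unit_root (N : nat) : Cmod (unit_root N) = 1.
Proof.
  unfold Cmod, unit_root; simpl fst; simpl snd.
  rewrite <- sqrt_1. f_equal. rewrite <- (sin2_cos2 (2 * PI / INR N)).
  unfold Rsqr. ring.
Qed.

Lemma unit_root_neq_0 (N : nat) : unit_root N <> 0%C.
Proof. apply Cmod_gt_0. rewrite Cmod_unit_root. lra. Qed.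

Lemma unit_root_pow_order (m : nat) : (unit_root (S m) ^ S m)%C = 1%C.
Proof.
  unfold unit_root. rewrite Cpow_cos_sin.
  replace (INR (S m) * (2 * PI / INR (S m))) with (2 * PI)
    by (field; apply not_0_INR; lia).
  now rewrite cos_2PI, sin_2PI.
Qed.

(** With [t = n pi / N] strictly between [0] and [pi], the real part
    [cos (2 t) = 1 - 2 (sin t) ^ 2] is less than [1]. *)
Lemma unit_root_pow_neq_1 (N n : nat) :
  (0 < n < N)%nat -> (unit_root N ^ n)%C <> 1%C.
Proof.
  intros [Hn HN] E. unfold unit_root in E. rewrite Cpow_cos_sin in E.
  apply (f_equal fst) in E. simpl in E.
  assert (N0 : 0 < INR N) by (apply lt_0_INR; lia).
  assert (n0 : 0 < INR n) by (apply lt_0_INR; lia).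
  assert (nN : INR n < INR N) by (apply lt_INR; lia).
  pose proof PI_RGT_0 as HPI.
  set (t := INR n / INR N * PI).
  assert (t0 : 0 < t < PI).
  { assert (0 < INR n / INR N < 1).
    { split; [now apply Rdiv_lt_0_compat|].
      apply (Rmult_lt_reg_r (INR N)); [exact N0|]. field_simplify; lra. }
    unfold t. nra. }
  replace (INR n * (2 * PI / INR N)) with (2 * t) in E by (unfold t; field; lra).
  rewrite cos_2a_sin in E.
  pose proof (sin_gt_0 t (proj1 t0) (proj2 t0)). nra.
Qed.

Lemma Csum_powers_unit (u : C) (m : nat) :
  (u ^ S m)%C = 1%C -> u <> 1%C -> Csum (fun k => u ^ k)%C m = RtoC 0.
Proof.
  intros Hu Hu1.
  assert (G : ((u - 1) * Csum (fun k => u ^ k) m = u ^ S m - 1)%C).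
  { clear. induction m as [|m IH].
    - rewrite Csum_O. simpl. ring.
    - rewrite Csum_S, Cmult_plus_distr_l, IH. simpl. ring. }
  rewrite Hu in G. replace (1 - 1)%C with (RtoC 0) in G by ring.
  destruct (Ceq_dec (Csum (fun k => u ^ k)%C m) 0) as [E|E]; [exact E|].
  exfalso. apply Hu1.
  assert (u - 1 = 0)%C.
  { destruct (Ceq_dec (u - 1) 0) as [E'|E']; [exact E'|].
    exfalso. now apply (Cmult_neq_0 _ _ E' E). }
  replace u with (u - 1 + 1)%C by ring. rewrite H. ring.
Qed.

Lemma Csum_powers_Cmod (u : C) (m : nat) :
  Cmod u = 1 -> Cmod (Csum (fun k => u ^ k)%C m) <= INR (S m).
Proof.
  intros Hu. eapply Rle_trans; [apply Csum_Cmod_le|].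
  rewrite (sum_n_ext _ (fun _ => 1)).
  - rewrite sum_n_const. lra.
  - intros k. now rewrite Cmod_pow, Hu, pow1.
Qed.

(** The sum over [k] is zero unless [S m] divides [S n], so the series starts at
    [n = m].  It serves for the regular part of a Laurent series without its
    constant term, with [w] a root of unity, and for the principal part, with the
    inverse root. *)
Lemma root_sum_series_bound (d : nat -> C) (w : C) (m : nat) (M : R) (l : C) :
  Cmod w = 1 -> (w ^ S m)%C = 1%C ->
  (forall n, (0 < n < S m)%nat -> (w ^ n)%C <> 1%C) ->
  (forall n, Cmod (d n) <= M * (1/2) ^ n) ->
  Cseries (fun n => d n * Csum (fun k => (w ^ S n) ^ k) m)%C l ->
  Cmod l <= 2 * (INR (S m) * M) * (1/2) ^ m.
Proof.
  intros H1 Hord Hprim Hd Hl.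
  apply (Cseries_half_bound_from m _ l _ Hl).
  - intros n Hn. rewrite Csum_powers_unit; [ring| |].
    + rewrite <- Cpow_mult_r, Nat.mul_comm, Cpow_mult_r, Hord. apply Cpow_1_l.
    + apply Hprim. lia.
  - intros n. rewrite Cmod_mult.
    assert (B : Cmod (Csum (fun k => (w ^ S n) ^ k)%C m) <= INR (S m)).
    { apply Csum_powers_Cmod. now rewrite Cmod_pow, H1, pow1. }
    pose proof (Cmod_ge_0 (d n)). pose proof (pos_INR (S m)).
    replace (INR (S m) * M * (1/2) ^ n) with ((M * (1/2)^n) * INR (S m)) by ring.
    apply Rmult_le_compat; auto using Cmod_ge_0.
Qed.

Lemma half_pow_le_0 (x K : R) : (forall m, x <= K * (1/2) ^ m) -> x <= 0.
Proof.
  intros H.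
  assert (L : is_lim_seq (fun m => K * (1/2)^m) (K * 0)).
  { apply (is_lim_seq_scal_l _ K 0). apply is_lim_seq_geom. rewrite Rabs_pos_eq; lra. }
  rewrite Rmult_0_r in L.
  apply (is_lim_seq_le (fun _ => x) _ x 0 H (is_lim_seq_const x) L).
Qed.

(** The body of [is_laurent] with its radius made explicit, so that two expansions
    can be compared on one circle. *)
Definition laurent_within (f : C -> C) (a : C) (c : Z -> C) (rho : R) : Prop :=
  forall z : C, 0 < Cmod (z - a) < rho ->
      exists p q : C,
        is_series (fun n : nat => c (Z.of_nat n) * (z - a) ^ n)%C p /\
        is_series (fun k : nat => c (- Z.of_nat (S k))%Z * / (z - a) ^ (S k))%C q /\
        f z = (p + q)%C.

(** The sums of the two parts are only known to exist at each point; adding the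
    points one at a time avoids choosing them for all points at once. *)
Lemma laurent_within_sum (f : C -> C) (a : C) (c : Z -> C) (rho : R)
    (zz : nat -> C) (m : nat) :
  laurent_within f a c rho ->
  (forall k, 0 < Cmod (zz k) < rho) ->
  exists p q : C,
    Cseries (fun n => c (Z.of_nat n) * Csum (fun k => zz k ^ n) m)%C p /\
    Cseries (fun n => c (- Z.of_nat (S n))%Z * Csum (fun k => (/ zz k) ^ S n) m)%C q /\
    (p + q)%C = Csum (fun k => f (a + zz k)%C) m.
Proof.
  intros Hf Hz.
  assert (Hk : forall k, exists p q : C,
    Cseries (fun n => c (Z.of_nat n) * zz k ^ n)%C p /\
    Cseries (fun n => c (- Z.of_nat (S n))%Z * (/ zz k) ^ S n)%C q /\
    f (a + zz k)%C = (p + q)%C).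
  { intros k. destruct (Hf (a + zz k)%C) as (p & q & Hp & Hq & E);
      replace (a + zz k - a)%C with (zz k) in * by ring; [apply Hz|].
    exists p, q. split; [exact Hp|split; [|exact E]].
    refine (Cseries_ext _ _ _ _ Hq). intros n. cbv beta.
    rewrite Cpow_inv; [reflexivity|]. apply Cmod_gt_0. apply Hz. }
  induction m as [|m IH].
  - destruct (Hk 0%nat) as (p & q & Hp & Hq & E). exists p, q.
    split; [|split].
    + refine (Cseries_ext _ _ _ _ Hp). intros n. now rewrite Csum_O.
    + refine (Cseries_ext _ _ _ _ Hq). intros n. now rewrite Csum_O.
    + now rewrite Csum_O, E.
  - destruct IH as (p & q & Hp & Hq & E).
    destruct (Hk (S m)) as (p' & q' & Hp' & Hq' & E').
    exists (p + p')%C, (q + q')%C. split; [|split].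
    + refine (Cseries_ext _ _ _ _ (Cseries_plus _ _ _ _ Hp Hp')). intros n.
      rewrite Csum_S. ring.
    + refine (Cseries_ext _ _ _ _ (Cseries_plus _ _ _ _ Hq Hq')). intros n.
      rewrite Csum_S. ring.
    + rewrite Csum_S, <- E, E'. ring.
Qed.

(** Halving the modulus turns a bound for the terms into a geometric one. *)
Lemma term_half_bound (b u v : C) (n : nat) (M : R) :
  Cmod v <= Cmod u / 2 -> Cmod (b * u ^ n)%C <= M -> Cmod (b * v ^ n)%C <= M * (1/2) ^ n.
Proof.
  intros Huv. rewrite !Cmod_mult, !Cmod_pow. intros HM.
  apply Rle_trans with (Cmod b * (Cmod u / 2) ^ n).
  - apply Rmult_le_compat_l; [apply Cmod_ge_0|]. apply pow_incr.
    split; [apply Cmod_ge_0|exact Huv].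
  - unfold Rdiv. rewrite Rpow_mult_distr, <- Rmult_assoc, Rmult_1_l.
    apply Rmult_le_compat_r; [apply pow_le; lra|exact HM].
Qed.

(** On the circle of radius [r] the terms of both parts decrease like [(1/2) ^ n]:
    those of the regular part because they are bounded at radius [2 r], those of the
    principal part because they are bounded at radius [r / 2].  The finite sums of
    the non-constant terms over the [S m]-th roots of unity start at index [S m]. *)
Lemma laurent_circle_mean (f : C -> C) (a : C) (c : Z -> C) (r : R) :
  0 < r -> laurent_within f a c (4 * r) ->
  exists K, forall m,
    Cmod (Csum (fun k => f (a + r * unit_root (S m) ^ k)%C) m - INR (S m) * c 0%Z)%C
    <= INR (S m) * (K * (1/2) ^ m).
Proof.
  intros r0 Hf.
  assert (Hmod : forall x : R, 0 < x -> Cmod x = x).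
  { intros x Hx. rewrite Cmod_R. apply Rabs_pos_eq. lra. }
  assert (Cnz : forall x : R, 0 < x -> RtoC x <> 0%C).
  { intros x Hx. apply Cmod_gt_0. rewrite Hmod; lra. }
  assert (B1 : exists M, forall n,
    Cmod (c (Z.of_nat (S n)) * RtoC r ^ S n)%C <= M * (1/2) ^ n).
  { destruct (Hf (a + RtoC (2 * r))%C) as (p & q & Hp & _ & _);
      replace (a + RtoC (2 * r) - a)%C with (RtoC (2 * r)) in * by ring;
      [rewrite Hmod; lra|].
    destruct (Cseries_terms_bounded _ _ Hp) as [M [M0 HM]].
    exists M. intros n. eapply Rle_trans.
    - apply (term_half_bound _ (RtoC (2 * r)) _ _ M); [rewrite !Hmod; lra|apply HM].
    - simpl. pose proof (pow_lt (1/2) n ltac:(lra)). nra. }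
  assert (B2 : exists M, forall n,
    Cmod (c (- Z.of_nat (S n))%Z * (/ RtoC r) ^ S n)%C <= M * (1/2) ^ n).
  { destruct (Hf (a + RtoC (r / 2))%C) as (p & q & _ & Hq & _);
      replace (a + RtoC (r / 2) - a)%C with (RtoC (r / 2)) in * by ring;
      [rewrite Hmod; lra|].
    destruct (Cseries_terms_bounded _ _ Hq) as [M [M0 HM]].
    exists M. intros n. eapply Rle_trans.
    - apply (term_half_bound _ (/ RtoC (r / 2)) _ _ M).
      + rewrite <- !RtoC_inv by lra. rewrite !Hmod; [right; field; lra| |];
          apply Rinv_0_lt_compat; lra.
      + rewrite Cpow_inv; [apply HM|apply Cnz; lra].
    - simpl. pose proof (pow_lt (1/2) n ltac:(lra)). nra. }
  destruct B1 as [M1 B1], B2 as [M2 B2].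
  exists (2 * M1 + 2 * M2). intros m.
  set (w := unit_root (S m)).
  assert (w1 : Cmod w = 1) by apply Cmod_unit_root.
  assert (wnz : w <> 0%C) by apply unit_root_neq_0.
  assert (word : (w ^ S m)%C = 1%C) by apply unit_root_pow_order.
  assert (wprim : forall n, (0 < n < S m)%nat -> (w ^ n)%C <> 1%C)
    by (intros n; apply unit_root_pow_neq_1).
  destruct (laurent_within_sum f a c (4 * r) (fun k => RtoC r * w ^ k)%C m Hf)
    as (p & q & Hp & Hq & E).
  { intros k. rewrite Cmod_mult, Cmod_pow, w1, pow1, Hmod; lra. }
  rewrite <- E.
  apply Cseries_tail in Hp.
  assert (E0 : Csum (fun k => (RtoC r * w ^ k) ^ 0)%C m = RtoC (INR (S m))).
  { clearbody w. clear. induction m as [|m IH]; [now rewrite Csum_O|].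
    rewrite Csum_S, IH, (S_INR (S m)), RtoC_plus. reflexivity. }
  rewrite E0 in Hp. change (Z.of_nat 0) with 0%Z in Hp.
  assert (HP : Cmod (p - c 0%Z * INR (S m))%C <= 2 * (INR (S m) * M1) * (1/2) ^ m).
  { apply (root_sum_series_bound _ w m M1 _ w1 word wprim B1).
    refine (Cseries_ext _ _ _ _ Hp). intros n. cbv beta.
    rewrite <- Cmult_assoc. f_equal. rewrite <- Csum_scal. apply Csum_ext. intros k _.
    rewrite Cpow_mult_l, <- !Cpow_mult_r. now rewrite Nat.mul_comm. }
  assert (HQ : Cmod q <= 2 * (INR (S m) * M2) * (1/2) ^ m).
  { apply (root_sum_series_bound _ (/ w)%C m M2) with (4 := B2).
    - rewrite Cmod_inv, w1; [lra|exact wnz].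
    - rewrite Cpow_inv, word; [|exact wnz]. rewrite <- RtoC_inv by lra; now rewrite Rinv_1.
    - intros n Hn Ew. rewrite Cpow_inv in Ew by exact wnz. apply (wprim n Hn).
      pose proof (Cpow_nz w n wnz) as Hnz.
      replace (w ^ n)%C with (/ (/ w ^ n))%C by (field; exact Hnz).
      rewrite Ew, <- RtoC_inv by lra; now rewrite Rinv_1.
    - refine (Cseries_ext _ _ _ _ Hq). intros n. cbv beta.
      rewrite <- Cmult_assoc. f_equal. rewrite <- Csum_scal. apply Csum_ext. intros k _.
      rewrite <- Cpow_mult_r, (Nat.mul_comm (S n) k), Cpow_mult_r, <- Cpow_mult_l.
      f_equal. rewrite Cpow_inv by exact wnz. field.
      split; [now apply Cpow_nz|now apply Cnz]. }
  replace (p + q - INR (S m) * c 0%Z)%C with ((p - c 0%Z * INR (S m)) + q)%C by ring.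
  eapply Rle_trans; [apply Cmod_triangle|]. lra.
Qed.

(** Both constant terms are limits of the same means of [f]. *)
Lemma laurent_coeff_0_unique (f : C -> C) (a : C) (c c' : Z -> C) :
  is_laurent f a c -> is_laurent f a c' -> c 0%Z = c' 0%Z.
Proof.
  intros [rho [Hrho H]] [rho' [Hrho' H']].
  set (r := Rmin rho rho' / 4).
  assert (r0 : 0 < r) by (unfold r, Rmin; destruct (Rle_dec rho rho'); lra).
  assert (r1 : 4 * r <= rho /\ 4 * r <= rho')
    by (unfold r, Rmin; destruct (Rle_dec rho rho'); lra).
  destruct (laurent_circle_mean f a c r r0) as [K HK].
  { intros z Hz. apply H. lra. }
  destruct (laurent_circle_mean f a c' r r0) as [K' HK'].
  { intros z Hz. apply H'. lra. }
  enough (Hle : Cmod (c 0%Z - c' 0%Z)%C <= 0).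
  { replace (c 0%Z) with (c' 0%Z + (c 0%Z - c' 0%Z))%C by ring.
    rewrite (Cmod_eq_0 (c 0%Z - c' 0%Z)%C); [ring|].
    apply Rle_antisym; [exact Hle|apply Cmod_ge_0]. }
  apply (half_pow_le_0 _ (K + K')). intros m.
  specialize (HK m). specialize (HK' m).
  set (T := Csum _ m) in *.
  assert (m0 : 0 < INR (S m)) by (apply lt_0_INR; lia).
  apply (Rmult_le_reg_l (INR (S m))); [exact m0|].
  replace (INR (S m) * Cmod (c 0%Z - c' 0%Z))
    with (Cmod ((T - INR (S m) * c' 0%Z) + - (T - INR (S m) * c 0%Z))%C).
  - eapply Rle_trans; [apply Cmod_triangle|]. rewrite Cmod_opp. lra.
  - replace ((T - INR (S m) * c' 0%Z) + - (T - INR (S m) * c 0%Z))%C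
      with (INR (S m) * (c 0%Z - c' 0%Z))%C by ring.
    rewrite Cmod_mult, Cmod_R, Rabs_pos_eq; lra.
Qed.

(** * The Cauchy product of complex series *)

Lemma sum_n_convolution {K : Ring} (a b : nat -> K) (N : nat) :
  sum_n (fun n => sum_n (fun k => mult (a k) (b (n - k)%nat)) n) N
  = sum_n (fun i => mult (a i) (sum_n b (N - i))) N.
Proof.
  induction N as [|N IH]; [now rewrite !sum_O|].
  rewrite sum_Sn, IH, !sum_Sn, plus_assoc, <- sum_n_plus, Nat.sub_diag, sum_O.
  f_equal. apply sum_n_ext_loc. intros i Hi.
  replace (S N - i)%nat with (S (N - i)) by lia.
  now rewrite sum_Sn, mult_distr_l.
Qed.

(** Both differences are sums over the indices from [n + 1] to [N]. *)
Lemma Csum_Cmod_diff (b : nat -> C) (n N : nat) :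
  (n <= N)%nat ->
  Cmod (Csum b N - Csum b n)%C
  <= sum_n (fun k => Cmod (b k)) N - sum_n (fun k => Cmod (b k)) n.
Proof.
  intros H. induction H as [|N H IH].
  - replace (Csum b n - Csum b n)%C with (RtoC 0) by ring. rewrite Cmod_0. lra.
  - rewrite Csum_S, sum_Sn. unfold plus at 1; simpl.
    replace (Csum b N + b (S N) - Csum b n)%C
      with ((Csum b N - Csum b n) + b (S N))%C by ring.
    eapply Rle_trans; [apply Cmod_triangle|]. lra.
Qed.

Lemma Csum_minus (a b : nat -> C) n :
  Csum (fun k => a k - b k)%C n = (Csum a n - Csum b n)%C.
Proof.
  induction n as [|n IH]; [now rewrite !Csum_O|]. rewrite !Csum_S, IH. ring.
Qed.

Lemma Csum_mult_r (u : C) (a : nat -> C) n :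
  Csum (fun k => a k * u)%C n = (Csum a n * u)%C.
Proof. exact (sum_n_mult_r (K := C_Ring) u a n). Qed.

Lemma Csum_convolution (a b : nat -> C) (N : nat) :
  Csum (fun n => Csum (fun k => a k * b (n - k)%nat)%C n) N
  = Csum (fun i => a i * Csum b (N - i))%C N.
Proof. exact (sum_n_convolution (K := C_Ring) a b N). Qed.

(** The left side is the modulus of the sum of the products [a i * b j] with
    [i, j <= N < i + j]; the right side is the same sum for the moduli of the factors.
    This transfers the real Cauchy product to complex series. *)
Lemma Csum_cauchy_defect (a b : nat -> C) (N : nat) :
  Cmod (Csum a N * Csum b N
        - Csum (fun n => Csum (fun k => a k * b (n - k)%nat)%C n) N)%C
  <= sum_n (fun k => Cmod (a k)) N * sum_n (fun k => Cmod (b k)) N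
     - sum_n (fun n => sum_n (fun k => Cmod (a k) * Cmod (b (n - k)%nat)) n) N.
Proof.
  rewrite Csum_convolution, <- Csum_mult_r, <- Csum_minus.
  assert (E : sum_n (fun n => sum_n (fun k => Cmod (a k) * Cmod (b (n - k)%nat)) n) N
    = sum_n (fun i => Cmod (a i) * sum_n (fun k => Cmod (b k)) (N - i)) N)
    by exact (sum_n_convolution (K := R_Ring) (fun k => Cmod (a k)) (fun k => Cmod (b k)) N).
  rewrite E.
  assert (E2 : sum_n (fun k => Cmod (a k)) N * sum_n (fun k => Cmod (b k)) N
    = sum_n (fun i => Cmod (a i) * sum_n (fun k => Cmod (b k)) N) N)
    by exact (eq_sym (sum_n_mult_r (K := R_Ring) _ (fun k => Cmod (a k)) N)).
  rewrite E2. clear E E2.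
  eapply Rle_trans; [apply Csum_Cmod_le|].
  rewrite !sum_n_Reals, <- minus_sum. apply sum_Rle. intros i Hi.
  replace (a i * Csum b N - a i * Csum b (N - i))%C
    with (a i * (Csum b N - Csum b (N - i)))%C by ring.
  rewrite Cmod_mult, <- Rmult_minus_distr_l.
  apply Rmult_le_compat_l; [apply Cmod_ge_0|].
  rewrite <- (sum_n_Reals (fun k => Cmod (b k)) N). apply Csum_Cmod_diff. lia.
Qed.

Lemma Cseries_lim (a : nat -> C) (l : C) :
  Cseries a l <-> is_lim_seq (fun n => Cmod (Csum a n - l)%C) 0.
Proof.
  rewrite Cseries_eps, <- is_lim_seq_spec.
  assert (E : forall n, Rabs (Cmod (Csum a n - l) - 0) = Cmod (Csum a n - l)).
  { intros n. rewrite Rminus_0_r. apply Rabs_pos_eq, Cmod_ge_0. }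
  split.
  - intros H eps. destruct (H eps (cond_pos eps)) as [N HN].
    exists N. intros n Hn. rewrite E. now apply HN.
  - intros H eps He. destruct (H (mkposreal eps He)) as [N HN].
    exists N. intros n Hn. rewrite <- E. now apply HN.
Qed.

(** The product of the partial sums tends to [la * lb], and the defect tends to [0]
    because the Cauchy product of the series of moduli converges to the product of
    their sums. *)
Lemma Cseries_mult (a b : nat -> C) (la lb : C) :
  Cseries a la -> Cseries b lb ->
  ex_series (fun n => Cmod (a n)) -> ex_series (fun n => Cmod (b n)) ->
  Cseries (fun n => Csum (fun k => a k * b (n - k)%nat)%C n) (la * lb)%C.
Proof.
  rewrite !Cseries_lim. intros Ha Hb [A HA] [B HB].
  assert (HAB : is_series
    (fun n => sum_n (fun k => Cmod (a k) * Cmod (b (n - k)%nat)) n) (A * B)).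
  { refine (is_series_ext _ _ _ _ (is_series_mult_pos _ _ _ _ HA HB _ _));
      try (intros; apply Cmod_ge_0).
    intros n. now rewrite sum_n_Reals. }
  set (x := fun N => Cmod (Csum a N - la)%C) in *.
  set (y := fun N => Cmod (Csum b N - lb)%C) in *.
  set (d := fun N => sum_n (fun k => Cmod (a k)) N * sum_n (fun k => Cmod (b k)) N
    - sum_n (fun n => sum_n (fun k => Cmod (a k) * Cmod (b (n - k)%nat)) n) N).
  apply (is_lim_seq_le_le (fun _ => 0) _
    (fun N => d N + ((Cmod la + x N) * y N + Cmod lb * x N))).
  - intros N. split; [apply Cmod_ge_0|].
    pose proof (Csum_cauchy_defect a b N) as D. fold (d N) in D.
    set (AN := Csum a N) in *. set (BN := Csum b N) in *.
    set (CN := Csum (fun n => Csum _ n) N) in *.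
    replace (CN - la * lb)%C
      with (- (AN * BN - CN) + ((la + (AN - la)) * (BN - lb) + lb * (AN - la)))%C by ring.
    eapply Rle_trans; [apply Cmod_triangle|]. rewrite Cmod_opp.
    apply Rplus_le_compat; [exact D|].
    eapply Rle_trans; [apply Cmod_triangle|]. rewrite !Cmod_mult.
    apply Rplus_le_compat_r, Rmult_le_compat_r; [apply Cmod_ge_0|].
    apply Cmod_triangle.
  - apply is_lim_seq_const.
  - replace 0 with ((A * B - A * B) + ((Cmod la + 0) * 0 + Cmod lb * 0)) by ring.
    apply is_lim_seq_plus'.
    + apply is_lim_seq_minus'; [apply is_lim_seq_mult'|]; assumption.
    + apply is_lim_seq_plus'; apply is_lim_seq_mult'; try assumption.
      * apply is_lim_seq_plus'; [apply is_lim_seq_const|assumption].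
      * apply is_lim_seq_const.
Qed.

(** * The power series of the square root *)

(** Coefficients of [y = b sqrt (1 + k z ^ 2)], read off from the differential
    equation [(1 + k z ^ 2) y' = k z y]. *)
Fixpoint sqrt_coef (b k : R) (n : nat) : R :=
  match n with
  | O => b
  | S O => 0
  | S (S m) => k * (1 - INR m) / (INR m + 2) * sqrt_coef b k m
  end.

Lemma sqrt_coef_step b k n :
  (INR n + 2) * sqrt_coef b k (S (S n)) = k * (1 - INR n) * sqrt_coef b k n.
Proof. cbn [sqrt_coef]. field. pose proof (pos_INR n). lra. Qed.

Lemma nat_ind2 (P : nat -> Prop) :
  P 0%nat -> P 1%nat -> (forall n, P n -> P (S (S n))) -> forall n, P n.
Proof.
  intros H0 H1 H n. enough (P n /\ P (S n)) by tauto.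
  induction n as [|n [IH1 IH2]]; auto.
Qed.

Lemma sqrt_coef_bound b k n : 0 <= b -> 0 <= k ->
  Rabs (sqrt_coef b k n) <= b * (1 + k) ^ n.
Proof.
  intros Hb Hk. induction n as [| |n IH] using nat_ind2.
  - simpl. rewrite Rabs_pos_eq; lra.
  - simpl. rewrite Rabs_R0. apply Rmult_le_pos; lra.
  - pose proof (pos_INR n).
    assert (Q : Rabs ((1 - INR n) / (INR n + 2)) <= 1).
    { apply Rabs_le. split.
      - apply (Rmult_le_reg_r (INR n + 2)); [lra|]. field_simplify; lra.
      - apply (Rmult_le_reg_r (INR n + 2)); [lra|]. field_simplify; lra. }
    cbn [sqrt_coef].
    replace (k * (1 - INR n) / (INR n + 2) * sqrt_coef b k n)
      with (k * ((1 - INR n) / (INR n + 2) * sqrt_coef b k n)) by (field; lra).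
    rewrite !Rabs_mult, (Rabs_pos_eq k Hk).
    replace (b * (1 + k) ^ S (S n)) with ((1 + k) ^ 2 * (1 * (b * (1 + k) ^ n)))
      by (simpl; ring).
    apply Rmult_le_compat; [lra| |simpl; nra|].
    + apply Rmult_le_pos; apply Rabs_pos.
    + apply Rmult_le_compat; auto using Rabs_pos.
Qed.

Definition self_conv (c : nat -> R) (n : nat) : R :=
  sum_f_R0 (fun i => c i * c (n - i)%nat) n.

Lemma sum_f_R0_rev (f : nat -> R) n :
  sum_f_R0 (fun i => f (n - i)%nat) n = sum_f_R0 f n.
Proof.
  induction n as [|n IH]; [reflexivity|].
  rewrite decomp_sum by lia. rewrite tech5, <- IH, Rplus_comm, Nat.sub_0_r.
  reflexivity.
Qed.

(** Reversing the order of summation exchanges the weights [i] and [n - i], whose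
    sum is [n].  On generating functions this is [2 y (z y') = z (y ^ 2)']. *)
Lemma self_conv_weighted (c : nat -> R) n :
  2 * sum_f_R0 (fun i => INR i * (c i * c (n - i)%nat)) n = INR n * self_conv c n.
Proof.
  set (f := fun i => INR i * (c i * c (n - i)%nat)).
  replace (2 * sum_f_R0 f n) with (sum_f_R0 f n + sum_f_R0 f n) by ring.
  rewrite <- (sum_f_R0_rev f n) at 1. rewrite <- plus_sum.
  unfold self_conv. rewrite scal_sum. apply sum_eq. intros i Hi. unfold f.
  replace (n - (n - i))%nat with i by lia. rewrite minus_INR by lia. ring.
Qed.

(** This is the differential equation [(1 + k z ^ 2) (y ^ 2)' = 2 k z y ^ 2] read on
    coefficients; the factor [2 - INR n] makes the square terminate. *)
Lemma sqrt_self_conv_step b k n :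
  (INR n + 2) * self_conv (sqrt_coef b k) (S (S n))
  = k * (2 - INR n) * self_conv (sqrt_coef b k) n.
Proof.
  set (c := sqrt_coef b k).
  pose proof (self_conv_weighted c (S (S n))) as W2.
  pose proof (self_conv_weighted c n) as W0.
  (* The terms [i = 0] and [i = 1] of the weighted sum vanish, because of the weight
     and of [c 1 = 0]; the recurrence of [c] applies to all others. *)
  rewrite (decomp_sum _ (S (S n))), Nat.pred_succ in W2 by lia.
  rewrite (decomp_sum _ (S n)), Nat.pred_succ in W2 by lia.
  assert (E : sum_f_R0 (fun i => INR (S (S i)) * (c (S (S i)) * c (S (S n) - S (S i))%nat)) n
    = k * (self_conv c n - sum_f_R0 (fun i => INR i * (c i * c (n - i)%nat)) n)).
  { unfold self_conv. rewrite <- minus_sum, scal_sum. apply sum_eq. intros i Hi.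
    change (S (S n) - S (S i))%nat with (n - i)%nat.
    pose proof (sqrt_coef_step b k i) as Hs. fold c in Hs.
    rewrite !S_INR. replace (INR i + 1 + 1) with (INR i + 2) by ring.
    rewrite <- Rmult_assoc, Hs. ring. }
  rewrite E in W2.
  change (c 1%nat) with 0 in W2. simpl (INR 0) in W2.
  rewrite !S_INR in W2.
  apply (f_equal (Rmult k)) in W0. lra.
Qed.

(** The square of the series is the polynomial [b ^ 2 (1 + k z ^ 2)]. *)
Lemma sqrt_self_conv_values b k :
  self_conv (sqrt_coef b k) 0 = b ^ 2 /\
  self_conv (sqrt_coef b k) 1 = 0 /\
  self_conv (sqrt_coef b k) 2 = k * b ^ 2 /\
  forall n, self_conv (sqrt_coef b k) (S (S (S n))) = 0.
Proof.
  set (e := self_conv (sqrt_coef b k)).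
  assert (St : forall n, (INR n + 2) * e (S (S n)) = k * (2 - INR n) * e n)
    by (intros n; apply sqrt_self_conv_step).
  assert (E0 : e 0%nat = b ^ 2) by (unfold e, self_conv; simpl; ring).
  assert (E1 : e 1%nat = 0) by (unfold e, self_conv; simpl; ring).
  split; [exact E0|split; [exact E1|split]].
  - pose proof (St 0%nat) as H. simpl in H. rewrite E0 in H. lra.
  - assert (Z : forall n, k * (2 - INR n) * e n = 0 -> e (S (S n)) = 0).
    { intros n H. rewrite <- St in H. pose proof (pos_INR n).
      apply Rmult_integral in H. lra. }
    intros n. induction n as [| |n IH] using nat_ind2; apply Z.
    + rewrite E1. ring.
    + simpl. ring.
    + rewrite IH. ring.
Qed.

Lemma Csum_RtoC (a : nat -> R) n : Csum (fun k => RtoC (a k)) n = RtoC (sum_f_R0 a n).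
Proof.
  induction n as [|n IH]; [now rewrite Csum_O|].
  now rewrite Csum_S, IH, <- RtoC_plus.
Qed.

Lemma sqrt_series_terms (b k : R) (z : C) n :
  0 <= b -> 0 <= k -> Cmod z < / (2 * (1 + k)) ->
  Cmod (sqrt_coef b k n * z ^ n)%C <= b * (1/2) ^ n.
Proof.
  intros Hb Hk Hz. rewrite Cmod_mult, Cmod_pow, Cmod_R.
  apply Rle_trans with (b * (1 + k) ^ n * (/ (2 * (1 + k))) ^ n).
  - apply Rmult_le_compat; [apply Rabs_pos|apply pow_le, Cmod_ge_0| |].
    + now apply sqrt_coef_bound.
    + apply pow_incr. pose proof (Cmod_ge_0 z). lra.
  - rewrite Rmult_assoc, <- Rpow_mult_distr. right. f_equal. f_equal. field. lra.
Qed.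

Lemma Cseries_unique (a : nat -> C) (l l' : C) :
  Cseries a l -> Cseries a l' -> l = l'.
Proof. exact (filterlim_locally_unique (V := C_NormedModule) (Csum a) l l'). Qed.

Lemma geom_half_ex_series (a : nat -> C) (M : R) :
  (forall n, Cmod (a n) <= M * (1/2) ^ n) -> ex_series (fun n => Cmod (a n)).
Proof.
  intros H. apply (ex_series_le (V := R_CompleteNormedModule)) with (fun n => M * (1/2) ^ n).
  - intros n. unfold norm; simpl; unfold abs; simpl.
    rewrite Rabs_pos_eq by apply Cmod_ge_0. apply H.
  - apply (ex_series_scal_l (V := R_NormedModule) M (fun n => (1/2) ^ n)).
    apply ex_series_geom. rewrite Rabs_pos_eq; lra.
Qed.

Lemma sqrt_series_square (b k : R) (z l : C) :
  0 <= b -> 0 <= k -> Cmod z < / (2 * (1 + k)) ->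
  Cseries (fun n => sqrt_coef b k n * z ^ n)%C l ->
  (l ^ 2)%C = (RtoC (b ^ 2) + RtoC (k * b ^ 2) * z ^ 2)%C.
Proof.
  intros Hb Hk Hz Hl.
  assert (Ab : ex_series (fun n => Cmod (sqrt_coef b k n * z ^ n)%C)).
  { apply (geom_half_ex_series _ b). intros n. now apply sqrt_series_terms. }
  pose proof (Cseries_mult _ _ _ _ Hl Hl Ab Ab) as P.
  replace (l ^ 2)%C with (l * l)%C by ring.
  refine (Cseries_unique _ _ _ P _). clear P Ab.
  destruct (sqrt_self_conv_values b k) as (E0 & E1 & E2 & E3).
  apply (Cseries_ext (fun n => RtoC (self_conv (sqrt_coef b k) n) * z ^ n)%C).
  { intros n. unfold self_conv. rewrite <- Csum_RtoC, <- Csum_mult_r. apply Csum_ext.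
    intros i Hi. rewrite RtoC_mult.
    replace (z ^ n)%C with (z ^ i * z ^ (n - i))%C
      by (rewrite <- Cpow_add_r; f_equal; lia).
    ring. }
  replace (RtoC (b ^ 2) + RtoC (k * b ^ 2) * z ^ 2)%C
    with (RtoC (b ^ 2) * z ^ 0 + (0 * z ^ 1 + (RtoC (k * b ^ 2) * z ^ 2 + 0)))%C by ring.
  rewrite <- E2, <- E0.
  rewrite <- E1 at 1.
  apply (Cseries_cons (fun n => RtoC (self_conv (sqrt_coef b k) n) * z ^ n)%C).
  apply (Cseries_cons (fun n => RtoC (self_conv (sqrt_coef b k) (S n)) * z ^ S n)%C).
  apply (Cseries_cons (fun n => RtoC (self_conv (sqrt_coef b k) (S (S n))) * z ^ S (S n))%C).
  apply (Cseries_ext (fun _ => RtoC 0)); [|exact Cseries_0].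
  intros n. rewrite E3. ring.
Qed.

Lemma sqrt_branch_exists (A B : R) :
  0 <= A -> 0 < B ->
  exists s : C -> C,
    analytic_at s 0 /\
    (exists delta : R, 0 < delta /\ forall z : C, Cmod z < delta ->
      (s z ^ 2)%C = (RtoC A * z ^ 2 + RtoC B)%C) /\
    s 0%C = RtoC (sqrt B).
Proof.
  intros HA HB.
  set (b := sqrt B). set (k := A / B). set (rho := / (2 * (1 + k))).
  assert (b0 : 0 < b) by now apply sqrt_lt_R0.
  assert (bb : b ^ 2 = B) by (unfold b; apply pow2_sqrt; lra).
  assert (k0 : 0 <= k) by (unfold k; apply Rdiv_le_0_compat; lra).
  assert (kB : k * B = A) by (unfold k; field; lra).
  assert (rho0 : 0 < rho) by (apply Rinv_0_lt_compat; lra).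
  set (s := fun z : C => epsilon (inhabits (RtoC 0))
    (fun l : C => Cseries (fun n => sqrt_coef b k n * z ^ n)%C l)).
  assert (Hs : forall z : C, Cmod z < rho ->
    Cseries (fun n => sqrt_coef b k n * z ^ n)%C (s z)).
  { intros z Hz. unfold s. apply epsilon_spec.
    apply (ex_series_le (V := C_CompleteNormedModule) _ (fun n => b * (1/2) ^ n)).
    - intros n. change (Cmod (sqrt_coef b k n * z ^ n)%C <= b * (1/2) ^ n).
      apply sqrt_series_terms; auto; lra.
    - apply (ex_series_scal_l (V := R_NormedModule) b (fun n => (1/2) ^ n)).
      apply ex_series_geom. rewrite Rabs_pos_eq; lra. }
  exists s. split; [|split].
  - exists rho, (fun n => RtoC (sqrt_coef b k n)). split; [exact rho0|].
    intros z Hz. replace (z - 0)%C with z in * by ring.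
    apply is_pseries_Cpow. now apply Hs.
  - exists rho. split; [exact rho0|]. intros z Hz.
    rewrite (sqrt_series_square b k z _ (Rlt_le _ _ b0) k0 Hz (Hs z Hz)).
    rewrite bb, kB. ring.
  - refine (Cseries_unique _ _ _ (Hs 0%C _) _); [now rewrite Cmod_0|].
    replace (RtoC b) with (RtoC (sqrt_coef b k 0) * 0 ^ 0 + 0)%C by (simpl; ring).
    apply (Cseries_cons (fun n => RtoC (sqrt_coef b k n) * 0 ^ n)%C).
    apply (Cseries_ext (fun _ => RtoC 0)); [|exact Cseries_0].
    intros n. rewrite Cpow_S. ring.
Qed.

(** * Branches of the square root near the origin *)

(** Divided by [z ^ 2], the remainder is again a power series with bounded sum. *)
Lemma pseries_second_order (c : nat -> C) (f : C -> C) (rho : R) :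
  0 < rho ->
  (forall z : C, Cmod z < rho -> Cseries (fun n => c n * z ^ n)%C (f z)) ->
  exists K : R, 0 <= K /\ forall z : C, Cmod z <= rho / 4 ->
    Cmod (f z - (c 0%nat + c 1%nat * z))%C <= K * Cmod z ^ 2.
Proof.
  intros Hrho H.
  assert (Hu : Cmod (RtoC (rho / 2)) = rho / 2) by (rewrite Cmod_R, Rabs_pos_eq; lra).
  destruct (Cseries_terms_bounded _ _ (H (RtoC (rho / 2)) ltac:(lra))) as [M [M0 HM]].
  set (K := M / (rho / 2) ^ 2).
  assert (p2 : 0 < (rho / 2) ^ 2) by (apply pow_lt; lra).
  assert (K0 : 0 <= K) by (apply Rlt_le, Rdiv_lt_0_compat; assumption).
  exists (2 * K). split; [lra|]. intros z Hz.
  pose proof (H z ltac:(lra)) as Hf.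
  do 2 apply Cseries_tail in Hf.
  replace (f z - c 0%nat * z ^ 0 - c 1%nat * z ^ 1)%C
    with (f z - (c 0%nat + c 1%nat * z))%C in Hf by ring.
  rewrite Rmult_assoc. apply (Cseries_half_bound _ _ _ Hf). intros n.
  replace (c (S (S n)) * z ^ S (S n))%C with (z ^ 2 * (c (S (S n)) * z ^ n))%C
    by (rewrite !Cpow_S; ring).
  rewrite Cmod_mult, Cmod_pow.
  replace (K * Cmod z ^ 2 * (1/2) ^ n) with (Cmod z ^ 2 * (K * (1/2) ^ n)) by ring.
  apply Rmult_le_compat_l; [apply pow_le, Cmod_ge_0|].
  apply (term_half_bound _ (RtoC (rho / 2))); [lra|].
  unfold K. apply (Rmult_le_reg_r ((rho / 2) ^ 2)); [exact p2|].
  unfold Rdiv at 3. rewrite Rmult_assoc, Rinv_l, Rmult_1_r by lra.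
  specialize (HM (S (S n))). rewrite Cmod_mult, Cmod_pow, Hu in *.
  simpl in *. lra.
Qed.

(** Writing [f z = x + c1 z + h z] with [h z = O(z ^ 2)], squaring leaves
    [2 x c1 z = O(z ^ 2)]; the modulus of [2 x c1] is therefore at most a constant
    times [t] for every small real [z = t]. *)
Lemma sqrt_branch_coef_1 (c : nat -> C) (f : C -> C) (rho x A : R) :
  0 < rho -> 0 < x ->
  (forall z : C, Cmod z < rho -> Cseries (fun n => c n * z ^ n)%C (f z)) ->
  c 0%nat = RtoC x ->
  (forall z : C, Cmod z < rho -> (f z ^ 2)%C = (RtoC A * z ^ 2 + RtoC (x ^ 2))%C) ->
  c 1%nat = 0%C.
Proof.
  intros Hrho Hx Hf H0 Hsq.
  destruct (pseries_second_order c f rho Hrho Hf) as [K [K0 HK]]. rewrite H0 in HK.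
  set (d := Rmin (rho / 4) 1).
  assert (d0 : 0 < d) by (apply Rmin_pos; lra).
  assert (d1 : d <= rho / 4) by apply Rmin_l.
  assert (d2 : d <= 1) by apply Rmin_r.
  set (e := Cmod (c 1%nat)). assert (e0 : 0 <= e) by apply Cmod_ge_0.
  set (L := Rabs A + e ^ 2 + K * (2 * x + 2 * e + K)).
  assert (Main : forall t, 0 < t <= d -> 2 * x * e <= L * t).
  { intros t Ht. set (z := RtoC t).
    assert (Ez : Cmod z = t) by (unfold z; rewrite Cmod_R, Rabs_pos_eq; lra).
    specialize (HK z ltac:(lra)). specialize (Hsq z ltac:(lra)).
    set (h := (f z - (x + c 1%nat * z))%C) in *.
    assert (Id : (RtoC (2 * x) * c 1%nat * z
      = RtoC A * z ^ 2 + - (c 1%nat ^ 2 * z ^ 2)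
        + - (h * (RtoC (2 * x) + RtoC 2 * (c 1%nat * z) + h)))%C).
    { assert (Ef : f z = (RtoC x + c 1%nat * z + h)%C) by (unfold h; ring).
      rewrite Ef in Hsq. rewrite RtoC_pow in Hsq.
      replace (RtoC A * z ^ 2)%C with ((x + c 1%nat * z + h) ^ 2 - x ^ 2)%C
        by (rewrite Hsq; ring).
      rewrite RtoC_mult. ring. }
    assert (hK : Cmod h <= K * t ^ 2) by now rewrite Ez in HK.
    assert (t2 : 0 <= t ^ 2 <= 1) by (split; nra).
    assert (hK1 : Cmod h <= K) by nra.
    assert (B : Cmod (RtoC (2 * x) + RtoC 2 * (c 1%nat * z) + h)%C <= 2 * x + 2 * e + K).
    { eapply Rle_trans; [apply Cmod_triangle|]. apply Rplus_le_compat; [|exact hK1].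
      eapply Rle_trans; [apply Cmod_triangle|]. rewrite !Cmod_mult, Ez, !Cmod_R.
      fold e. rewrite (Rabs_pos_eq 2), (Rabs_pos_eq (2 * x)) by lra.
      assert (e * t <= e * 1) by (apply Rmult_le_compat_l; lra). lra. }
    apply (f_equal Cmod) in Id. rewrite !Cmod_mult, Ez, Cmod_R in Id.
    fold e in Id. rewrite Rabs_pos_eq in Id by lra.
    apply (Rmult_le_reg_r t); [lra|]. rewrite Id.
    eapply Rle_trans; [apply Cmod_triangle|]. rewrite Cmod_opp, Cmod_mult.
    eapply Rle_trans; [apply Rplus_le_compat_r, Cmod_triangle|].
    rewrite Cmod_opp, !Cmod_mult, !Cmod_pow, Cmod_R, Ez. fold e.
    assert (P : Cmod h * Cmod (RtoC (2 * x) + RtoC 2 * (c 1%nat * z) + h)%C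
      <= K * t ^ 2 * (2 * x + 2 * e + K)).
    { apply Rmult_le_compat; auto using Cmod_ge_0. }
    unfold L. lra. }
  apply Cmod_eq_0. fold e. apply Rle_antisym; [|exact e0].
  apply (half_pow_le_0 _ (L * d / (2 * x))). intros m.
  assert (q : 0 < (1/2) ^ m <= 1).
  { split; [apply pow_lt; lra|].
    pose proof (pow_incr (1/2) 1 m ltac:(lra)) as Q. now rewrite pow1 in Q. }
  specialize (Main (d * (1/2) ^ m) ltac:(nra)).
  apply (Rmult_le_reg_l (2 * x)); [lra|].
  replace (2 * x * (L * d / (2 * x) * (1 / 2) ^ m)) with (L * (d * (1/2) ^ m)) by (field; lra).
  exact Main.
Qed.

Lemma sqrt_branch_series (r1 r2 : R) (s : C -> C) :
  is_sqrt_branch r1 r2 s ->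
  exists (rho x : R) (c : nat -> C), 0 < rho /\ 0 < x /\
    s 0%C = RtoC x /\ c 0%nat = RtoC x /\
    (forall z : C, Cmod z < rho -> Cseries (fun n => c n * z ^ n)%C (s z)) /\
    (forall z : C, Cmod z < rho -> (s z ^ 2)%C = radicand r1 r2 z).
Proof.
  intros [[rho [c [Hrho Hs]]] [[delta [Hd Hsq]] [x [Hx Hs0]]]].
  exists (Rmin rho delta), x, c.
  assert (Hser : forall z : C, Cmod z < rho -> Cseries (fun n => c n * z ^ n)%C (s z)).
  { intros z Hz. apply is_pseries_Cpow. specialize (Hs z).
    replace (z - 0)%C with z in Hs by ring. now apply Hs. }
  split; [now apply Rmin_pos|]. split; [exact Hx|]. split; [exact Hs0|]. split; [|split].
  - rewrite <- Hs0.
    destruct (pseries_second_order c s rho Hrho Hser) as [K [K0 HK]].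
    specialize (HK 0%C). rewrite Cmod_0 in HK. specialize (HK ltac:(lra)).
    replace (c 0%nat) with (s 0%C - (s 0%C - (c 0%nat + c 1%nat * 0)))%C by ring.
    rewrite (Cmod_eq_0 (s 0%C - (c 0%nat + c 1%nat * 0))%C); [ring|].
    apply Rle_antisym; [simpl in HK; lra|apply Cmod_ge_0].
  - intros z Hz. apply Hser. pose proof (Rmin_l rho delta). lra.
  - intros z Hz. apply Hsq. pose proof (Rmin_r rho delta). lra.
Qed.

Lemma radicand_RtoC (r1 r2 : R) (z : C) : 0 < r1 -> 0 < r2 ->
  radicand r1 r2 z = (RtoC (1 / (r1 * r2)) * z ^ 2 + RtoC (1 / r1 + 1 / r2))%C.
Proof.
  intros H1 H2. unfold radicand.
  rewrite RtoC_plus, !RtoC_div, RtoC_mult by nra.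
  field. split; intros E; apply RtoC_inj in E; lra.
Qed.

(** The two square roots of a positive real are opposite, and the negative one is
    at distance more than [x = s 0] from [s 0], whereas [s xi] tends to [s 0]. *)
Lemma sqrt_branch_real_positive (r1 r2 : R) (s : C -> C) :
  0 < r1 -> 0 < r2 -> is_sqrt_branch r1 r2 s ->
  exists delta : R, 0 < delta /\ forall xi : R, 0 < xi < delta ->
    s (RtoC xi) = RtoC (sqrt (1 / (r1 * r2) * xi ^ 2 + (1 / r1 + 1 / r2))).
Proof.
  intros H1 H2 Hs.
  destruct (sqrt_branch_series r1 r2 s Hs) as (rho & x & c & Hrho & Hx & _ & H0 & Hf & Hsq).
  destruct (pseries_second_order c s rho Hrho Hf) as [K [K0 HK]]. rewrite H0 in HK.
  (* For [xi <= 1] the estimate gives [Cmod (s xi - x) <= (Cmod (c 1) + K) xi],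
     which is less than [x] when [xi < x / (Cmod (c 1) + K + 1)]. *)
  set (e := Cmod (c 1%nat)). assert (e0 : 0 <= e) by apply Cmod_ge_0.
  set (d := Rmin (Rmin (rho / 4) 1) (x / (e + K + 1))).
  assert (d0 : 0 < d).
  { repeat apply Rmin_pos; try lra. apply Rdiv_lt_0_compat; lra. }
  assert (d1 : d <= rho / 4 /\ d <= 1).
  { pose proof (Rmin_l (Rmin (rho / 4) 1) (x / (e + K + 1))).
    pose proof (Rmin_l (rho / 4) 1). pose proof (Rmin_r (rho / 4) 1). unfold d. lra. }
  assert (d2 : d <= x / (e + K + 1)) by apply Rmin_r.
  exists d. split; [exact d0|]. intros xi Hxi.
  assert (Ez : Cmod (RtoC xi) = xi) by (rewrite Cmod_R, Rabs_pos_eq; lra).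
  specialize (HK (RtoC xi) ltac:(lra)). specialize (Hsq (RtoC xi) ltac:(lra)).
  rewrite radicand_RtoC, <- RtoC_pow, <- RtoC_mult, <- RtoC_plus in Hsq by assumption.
  set (Q := 1 / (r1 * r2) * xi ^ 2 + (1 / r1 + 1 / r2)) in *.
  assert (Q0 : 0 < Q).
  { unfold Q.
    assert (0 < 1 / (r1 * r2)) by (apply Rdiv_lt_0_compat; nra).
    assert (0 < 1 / r1) by (apply Rdiv_lt_0_compat; lra).
    assert (0 < 1 / r2) by (apply Rdiv_lt_0_compat; lra).
    assert (0 < xi ^ 2) by (apply pow_lt; lra). nra. }
  pose proof (sqrt_lt_R0 Q Q0) as q0.
  assert (Hfac : ((s (RtoC xi) - sqrt Q) * (s (RtoC xi) + sqrt Q) = 0)%C).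
  { replace ((s (RtoC xi) - sqrt Q) * (s (RtoC xi) + sqrt Q))%C
      with (s (RtoC xi) ^ 2 - RtoC (sqrt Q) ^ 2)%C by ring.
    rewrite Hsq, <- RtoC_pow, pow2_sqrt by lra. ring. }
  destruct (Ceq_dec (s (RtoC xi) - sqrt Q) 0) as [E|E].
  { replace (s (RtoC xi)) with (s (RtoC xi) - sqrt Q + sqrt Q)%C by ring.
    rewrite E. ring. }
  destruct (Ceq_dec (s (RtoC xi) + sqrt Q) 0) as [E'|E'];
    [exfalso|exfalso; now apply (Cmult_neq_0 _ _ E E')].
  assert (Far : Cmod (s (RtoC xi) - x)%C = sqrt Q + x).
  { replace (s (RtoC xi) - x)%C with (s (RtoC xi) + sqrt Q - (sqrt Q + x))%C by ring.
    rewrite E'. replace (0 - (sqrt Q + x))%C with (- RtoC (sqrt Q + x))%C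
      by (rewrite RtoC_plus; ring).
    rewrite Cmod_opp, Cmod_R, Rabs_pos_eq; lra. }
  assert (Near : Cmod (s (RtoC xi) - x)%C <= (e + K) * xi).
  { replace (s (RtoC xi) - x)%C
      with ((s (RtoC xi) - (x + c 1%nat * RtoC xi)) + c 1%nat * RtoC xi)%C by ring.
    eapply Rle_trans; [apply Cmod_triangle|]. rewrite Cmod_mult. fold e.
    rewrite Ez in *. assert (xi ^ 2 <= xi) by nra. nra. }
  assert (Hd : d * (e + K + 1) <= x).
  { apply (Rmult_le_compat_r (e + K + 1)) in d2; [|lra].
    unfold Rdiv in d2. rewrite Rmult_assoc, Rinv_l in d2; lra. }
  nra.
Qed.

(** * The Laurent expansion and the Descartes formula *)

(** Coefficients of [V + 1 / z ^ 2 + (t / z) f z] for [f z] the sum of [c n * z ^ n]: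
    multiplication by [t / z] moves [c (n + 1)] to index [n].  The guard matters because
    [Z.to_nat] sends negative numbers to [0]. *)
Definition laurent_coef_of_shift (V t : C) (c : nat -> C) (n : Z) : C :=
  ((if Z.eqb n (-2) then 1 else 0) + (if Z.eqb n 0 then V else 0)
   + (if Z.ltb n (-1) then 0 else t * c (Z.to_nat (n + 1))))%C.

Lemma laurent_coef_of_shift_0 (V t : C) (c : nat -> C) :
  laurent_coef_of_shift V t c 0 = (V + t * c 1%nat)%C.
Proof.
  unfold laurent_coef_of_shift. change (Z.to_nat (0 + 1)) with 1%nat. simpl. ring.
Qed.

Lemma laurent_of_shifted_pseries (V t : C) (c : nat -> C) (f : C -> C) (rho : R) :
  0 < rho ->
  (forall z : C, Cmod z < rho -> Cseries (fun n => c n * z ^ n)%C (f z)) ->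
  is_laurent (fun z => V + 1 / z ^ 2 + t / z * f z)%C 0 (laurent_coef_of_shift V t c).
Proof.
  intros Hrho Hf. exists rho. split; [exact Hrho|]. intros z Hz.
  replace (z - 0)%C with z in * by ring.
  assert (z0 : z <> 0%C) by (apply Cmod_gt_0; lra).
  exists (V + t * / z * (f z - c 0%nat))%C, (t * c 0%nat * / z + / z ^ 2)%C.
  split; [|split].
  - pose proof (Cseries_tail _ _ (Hf z (proj2 Hz))) as H.
    apply (Cseries_scal (t * / z)%C) in H.
    assert (H1 : Cseries (fun n : nat => match n with O => V | _ => RtoC 0 end) (V + 0)%C)
      by exact (Cseries_cons (fun n => match n with O => V | _ => RtoC 0 end) _ Cseries_0).
    replace (V + 0)%C with V in H1 by ring.
    replace (V + t * / z * (f z - c 0%nat))%C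
      with (V + t * / z * (f z - c 0%nat * z ^ 0))%C by ring.
    refine (Cseries_ext _ _ _ _ (Cseries_plus _ _ _ _ H1 H)). intros n. cbv beta.
    unfold laurent_coef_of_shift.
    rewrite (proj2 (Z.eqb_neq _ _)), (proj2 (Z.ltb_ge _ _)) by lia.
    replace (Z.to_nat (Z.of_nat n + 1)) with (S n) by lia.
    rewrite Cpow_S. destruct n as [|n].
    + simpl (Z.eqb _ _). cbv iota. simpl (z ^ 0)%C. now field.
    + rewrite (proj2 (Z.eqb_neq _ _)) by lia. now field.
  - replace (t * c 0%nat * / z + / z ^ 2)%C
      with (laurent_coef_of_shift V t c (- Z.of_nat 1) * / z ^ 1
        + (laurent_coef_of_shift V t c (- Z.of_nat 2) * / z ^ 2 + 0))%C.
    + apply (Cseries_cons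
        (fun n => laurent_coef_of_shift V t c (- Z.of_nat (S n)) * / z ^ S n)%C).
      apply (Cseries_cons
        (fun n => laurent_coef_of_shift V t c (- Z.of_nat (S (S n))) * / z ^ S (S n))%C).
      apply (Cseries_ext (fun _ => RtoC 0)); [|exact Cseries_0]. intros n.
      unfold laurent_coef_of_shift.
      rewrite !(proj2 (Z.eqb_neq _ _)), (proj2 (Z.ltb_lt _ _)) by lia. ring.
    + unfold laurent_coef_of_shift.
      change (- Z.of_nat 1)%Z with (-1)%Z. change (- Z.of_nat 2)%Z with (-2)%Z.
      simpl (Z.eqb _ _). simpl (Z.to_nat _). change (Z.ltb (-1) (-1)) with false.
      change (Z.ltb (-2) (-1)) with true. cbv iota. now field.
  - now field.
Qed.

Lemma descartes_circle (r1 r2 : R) : 0 < r1 -> 0 < r2 ->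
  is_circle_of_radius
      (fun x y : R => (r1 + r2) * (x ^ 2 + y ^ 2) - 2 * r1 * r2 * y = 0)
      (r1 * r2 / (r1 + r2)).
Proof.
  intros H1 H2. split; [apply Rdiv_lt_0_compat; nra|].
  exists 0, (r1 * r2 / (r1 + r2)). intros x y.
  assert (E : (x - 0) ^ 2 + (y - r1 * r2 / (r1 + r2)) ^ 2 - (r1 * r2 / (r1 + r2)) ^ 2
    = ((r1 + r2) * (x ^ 2 + y ^ 2) - 2 * r1 * r2 * y) / (r1 + r2)) by (field; lra).
  split; intros H.
  - rewrite H in E. unfold Rdiv in E. rewrite Rmult_0_l in E. lra.
  - rewrite H in E. rewrite Rminus_diag in E. symmetry in E.
    apply Rmult_integral in E. destruct E as [E|E]; [exact E|].
    exfalso. revert E. apply Rinv_neq_0_compat. lra.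
Qed.

(** For [xi > 0] the factor [1 / xi] can be taken out of the square root. *)
Lemma descartes_rhs_square (sgn r1 r2 xi : R) : 0 < r1 -> 0 < r2 -> 0 < xi ->
  descartes_rhs sgn r1 r2 (xi ^ 2)
  = 1 / r1 + 1 / r2 + 1 / xi ^ 2
    + sgn * (2 / xi * sqrt (1 / (r1 * r2) * xi ^ 2 + (1 / r1 + 1 / r2))).
Proof.
  intros H1 H2 Hx. unfold descartes_rhs.
  set (Q := 1 / (r1 * r2) * xi ^ 2 + (1 / r1 + 1 / r2)).
  assert (x2 : 0 < xi ^ 2) by (apply pow_lt; lra).
  replace (1 / (r1 * r2) + 1 / (r2 * xi ^ 2) + 1 / (xi ^ 2 * r1)) with (Q / xi ^ 2)
    by (unfold Q; field; lra).
  assert (Q0 : 0 <= Q).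
  { assert (0 < 1 / (r1 * r2)) by (apply Rdiv_lt_0_compat; nra).
    assert (0 < 1 / r1) by (apply Rdiv_lt_0_compat; lra).
    assert (0 < 1 / r2) by (apply Rdiv_lt_0_compat; lra). unfold Q. nra. }
  rewrite sqrt_div_alt, sqrt_pow2 by lra. field. lra.
Qed.

Theorem mainTheorem2 :
  forall r1 r2 : R, 0 < r1 -> 0 < r2 ->
  (exists s : C -> C, is_sqrt_branch r1 r2 s) /\
  forall s : C -> C, is_sqrt_branch r1 r2 s ->
  forall sgn : R, sgn = 1 \/ sgn = -1 ->
    (exists delta : R, 0 < delta /\
       forall xi : R, 0 < xi < delta ->
         g sgn r1 r2 s (RtoC xi) = RtoC (descartes_rhs sgn r1 r2 (xi ^ 2))) /\
    is_dzc_value (g sgn r1 r2 s) 0 (RtoC (1 / r1 + 1 / r2)) /\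
    is_circle_of_radius
      (fun x y : R => (r1 + r2) * (x ^ 2 + y ^ 2) - 2 * r1 * r2 * y = 0)
      (r1 * r2 / (r1 + r2)) /\
    1 / (r1 * r2 / (r1 + r2)) = 1 / r1 + 1 / r2 /\
    dzc_descartes_r3_zero sgn r1 r2 s (r1 * r2 / (r1 + r2)).
Proof.
  intros r1 r2 H1 H2.
  assert (A0 : 0 < 1 / (r1 * r2)) by (apply Rdiv_lt_0_compat; nra).
  assert (B0 : 0 < 1 / r1 + 1 / r2)
    by (apply Rplus_lt_0_compat; apply Rdiv_lt_0_compat; lra).
  split.
  - destruct (sqrt_branch_exists _ _ (Rlt_le _ _ A0) B0) as (s & Han & (delta & Hd & Hsq) & Hs0).
    exists s. split; [exact Han|split].
    + exists delta. split; [exact Hd|]. intros z Hz.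
      rewrite radicand_RtoC by assumption. now apply Hsq.
    + exists (sqrt (1 / r1 + 1 / r2)). split; [now apply sqrt_lt_R0|exact Hs0].
  - intros s Hs sgn _.
    assert (Hr4 : 1 / (r1 * r2 / (r1 + r2)) = 1 / r1 + 1 / r2) by (field; lra).
    assert (Hdzc : is_dzc_value (g sgn r1 r2 s) 0 (RtoC (1 / r1 + 1 / r2))).
    { destruct (sqrt_branch_series r1 r2 s Hs) as (rho & x & c & Hrho & Hx & Hs0 & Hc0 & Hf & Hsq).
      assert (Hxx : x ^ 2 = 1 / r1 + 1 / r2).
      { specialize (Hsq 0%C). rewrite Cmod_0, Hs0, radicand_RtoC, <- RtoC_pow in Hsq by assumption.
        apply RtoC_inj. rewrite (Hsq Hrho). ring. }
      assert (Hc1 : c 1%nat = 0%C).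
      { apply (sqrt_branch_coef_1 c s rho x (1 / (r1 * r2)) Hrho Hx Hf Hc0).
        intros z Hz. rewrite (Hsq z Hz), radicand_RtoC, Hxx by assumption. reflexivity. }
      set (V := RtoC (1 / r1 + 1 / r2)).
      set (C0 := laurent_coef_of_shift V (2 * sgn) c).
      assert (HL : is_laurent (g sgn r1 r2 s) 0 C0).
      { destruct (laurent_of_shifted_pseries V (2 * sgn) c s rho Hrho Hf) as [rho' [Hrho' HL]].
        exists rho'. split; [exact Hrho'|]. intros z Hz.
        destruct (HL z Hz) as (p & q & Hp & Hq & E). exists p, q.
        split; [exact Hp|split; [exact Hq|]]. rewrite <- E.
        unfold g, V. rewrite RtoC_plus, !RtoC_div by lra. unfold Cdiv. ring. }
      split; [now exists C0|]. intros c' Hc'.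
      rewrite (laurent_coeff_0_unique _ _ _ _ Hc' HL).
      unfold C0. rewrite laurent_coef_of_shift_0, Hc1. ring. }
    split; [|split; [exact Hdzc|split; [now apply descartes_circle|split; [exact Hr4|]]]].
    + destruct (sqrt_branch_real_positive r1 r2 s H1 H2 Hs) as (delta & Hd & Hpos).
      exists delta. split; [exact Hd|]. intros xi Hxi.
      rewrite descartes_rhs_square by lra. unfold g. rewrite (Hpos xi Hxi).
      rewrite !RtoC_plus, !RtoC_mult, !RtoC_div, RtoC_pow by (try apply pow_nonzero; lra).
      reflexivity.
    + unfold dzc_descartes_r3_zero. now rewrite Hr4.
Qed.
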